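(* Let $m\ge4$ and let $F\neq[2^m]$ be a bipartite $2$-regular digraph of order $2m$. There exists an admissible $F$-decomposition of $J^*_{2m}$.
   Context: A $2$-regular digraph $[m_1^{\alpha_1},\ldots,m_t^{\alpha_t}]$ is a vertex-disjoint union of directed cycles, $\alpha_i$ of length $m_i$ (each length $\ge2$; a directed $2$-cycle on $\{u,v\}$ has arcs $uv,vu$); it is bipartite if all cycle lengths are even, and $[2^m]$ denotes $m$ disjoint directed $2$-cycles. For a graph $G$, $G^*$ replaces each edge $\{u,v\}$ by arcs $uv,vu$. $J_{2m}$ has vertex set $\{x_i,y_i: 0\le i\le m+1\}$ and edges $\{x_i,y_i\}$ ($1\le i\le m$) and $\{x_i,x_{i+1}\},\{y_i,y_{i+1}\},\{x_i,y_{i+1}\},\{y_i,x_{i+1}\},\{x_i,x_{i+2}\},\{y_i,y_{i+2}\},\{x_i,y_{i+2}\},\{y_i,x_{i+2}\}$ ($0\le i\le m-1$). An admissible $2$-regular subdigraph of $J^*_{2m}$ is a $2$-regular subdigraph of order $2m$ containing exactly one vertex of each of $\{x_0,x_m\},\{x_1,x_{m+1}\},\{y_0,y_m\},\{y_1,y_{m+1}\}$. An admissible $F$-decomposition of $J^*_{2m}$ is a partition of $A(J^*_{2m})$ into admissible $2$-regular subdigraphs each isomorphic to $F$. *)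

(* Defs.v *)
From mathcomp Require Import all_boot.

Set Implicit Arguments.
Unset Strict Implicit.
Unset Printing Implicit Defensive.

(* The vertex set is a subset of an ambient finite type, so that subgraphs
   live on the same type as the graph that contains them. *)
Record sgraph (T : finType) := SGraph {
  gverts : {set T};
  gedges : {set {set T}};
  gedgesP : [forall e in gedges, (e \subset gverts) && (#|e| == 2)]
}.

Record digraph (T : finType) := Digraph {
  verts : {set T};
  arcs : {set T * T};
  arcsP : [forall a in arcs,
             [&& a.1 \in verts, a.2 \in verts & a.1 != a.2]]
}.

Definition dorder (T : finType) (D : digraph T) := #|verts D|.

Definition subdigraph (T : finType) (H D : digraph T) :=
  (verts H \subset verts D) && (arcs H \subset arcs D).

Definition isomorphic (T1 T2 : finType) (D1 : digraph T1) (D2 : digraph T2) :=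
  exists f : T1 -> T2,
    [/\ {in verts D1 &, injective f},
        f @: verts D1 = verts D2 &
        {in verts D1 &, forall u v,
           ((f u, f v) \in arcs D2) = ((u, v) \in arcs D1)}].

(* [cs] lists the cycles; [uniq (flatten cs)] makes each of them a cycle
   without repeated vertices and any two of them vertex-disjoint. A cycle
   [:: u; v] contributes the arcs uv and vu. *)
Definition has_cycle_type (T : finType) (D : digraph T) (s : seq nat) :=
  exists cs : seq (seq T),
    [/\ perm_eq (map size cs) s,
        all (fun c => 2 <= size c) cs,
        uniq (flatten cs),
        verts D = [set v in flatten cs] &
        arcs D = [set a | has (fun c => (a.1 \in c) && (a.2 == next c a.1)) cs]].

Definition two_regular (T : finType) (D : digraph T) :=
  exists s, has_cycle_type D s.

Definition bipartite_two_regular (T : finType) (D : digraph T) :=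
  exists2 s, has_cycle_type D s & all (fun k => ~~ odd k) s.

Lemma star_arcsP (T : finType) (G : sgraph T) :
  [forall a in [set a : T * T | [set a.1; a.2] \in gedges G],
     [&& a.1 \in gverts G, a.2 \in gverts G & a.1 != a.2]].
Proof.
apply/forall_inP => a; rewrite inE => ea.
have /andP[/subsetP sub c2] := forall_inP (gedgesP G) _ ea.
rewrite !sub ?set21 ?set22 //=.
by apply/eqP => eq12; move: c2; rewrite eq12 setUid cards1.
Qed.

Definition star (T : finType) (G : sgraph T) : digraph T :=
  Digraph (star_arcsP G).

Section J.
Variable m : nat.

Definition Jvertex : finType := (bool * 'I_m.+2)%type.

(* [inord i] is [i] for [i <= m + 1]; no other index is used below. *)
Definition Jx (i : nat) : Jvertex := (false, inord i).
Definition Jy (i : nat) : Jvertex := (true, inord i).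

Definition Jedges : {set {set Jvertex}} :=
  (\bigcup_(i < m.+1 | 1 <= i) [set [set Jx i; Jy i]]) :|:
  (\bigcup_(i < m)
     [set [set Jx i; Jx i.+1]; [set Jy i; Jy i.+1];
          [set Jx i; Jy i.+1]; [set Jy i; Jx i.+1];
          [set Jx i; Jx i.+2]; [set Jy i; Jy i.+2];
          [set Jx i; Jy i.+2]; [set Jy i; Jx i.+2]]).

Lemma JedgesP : [forall e in Jedges, (e \subset [set: Jvertex]) && (#|e| == 2)].
Proof.
apply/forall_inP => e; rewrite subsetT /=.
have ne i j b c : i <= m.+1 -> j <= m.+1 -> (b != c) || (i != j) ->
    #|[set ((b, inord i) : Jvertex); (c, inord j)]| == 2.
  move=> hi hj h; rewrite cards2 eqSS eqb1 xpair_eqE negb_and.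
  by rewrite -[inord i == _](inj_eq val_inj) /= !inordK.
rewrite inE => /orP[] /bigcupP[i hi]; rewrite !inE.
  by move=> /eqP->; apply: ne; rewrite // ltnW // ltnS.
have [h0 h1 h2] : [/\ i <= m.+1, i.+1 <= m.+1 & i.+2 <= m.+1].
  by have := ltn_ord i; split; rewrite ?ltnS // ltnW // ltnW.
have n1 : i != i.+1 :> nat by rewrite neq_ltn ltnSn.
have n2 : i != i.+2 :> nat by rewrite neq_ltn leqnSn.
by move=> H; repeat (case/orP: H => [H|/eqP->]; last by apply: ne; rewrite ?n1 ?n2 ?orbT);
  move/eqP: H => ->; apply: ne; rewrite ?n1 ?n2 ?orbT.
Qed.

Definition J : sgraph Jvertex := SGraph JedgesP.

Definition exactly_one_of (V : {set Jvertex}) (u v : Jvertex) :=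
  #|V :&: [set u; v]| == 1.

Definition admissible (H : digraph Jvertex) :=
  [/\ subdigraph H (star J), two_regular H, dorder H = 2 * m &
      [&& exactly_one_of (verts H) (Jx 0) (Jx m),
          exactly_one_of (verts H) (Jx 1) (Jx m.+1),
          exactly_one_of (verts H) (Jy 0) (Jy m) &
          exactly_one_of (verts H) (Jy 1) (Jy m.+1)]].

Definition admissible_decomposition (T : finType) (F : digraph T)
    (P : {set {set Jvertex * Jvertex}}) :=
  partition P (arcs (star J)) /\
  {in P, forall B, exists H : digraph Jvertex,
     [/\ arcs H = B, admissible H & isomorphic H F]}.

End J.

(* Main.v *)
(* J is a strip of columns {x_i, y_i} in which every edge spans at most two
   columns, so it can be built from left to right.  We keep nine partial
   factors that use each arc of the part built so far exactly once, and glue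
   on blocks of a few columns.  Each of the nine factors has a fixed set of
   vertices that it occupies in the last two columns between blocks; the
   images of these vertices in the first two columns are the ones that it
   avoids, which is exactly admissibility.  Explicit blocks produce all short
   cycle types, and the types consisting of one long cycle and at most two short
   cycles.  The long cycle is started by an opening block, lengthened by 4 in
   all nine factors by each copy of a two-column loop block, and completed by a
   closing block with 2 or 3 columns, according to the parity of its
   half-length.  Every even cycle type other than [2^m] with m >= 3 is a union
   of these types: only 2-cycles on their own resist, as they are available
   alone just in multiples of three. *)

Require Import Defs.
From mathcomp Require Import all_boot zify.

Set Implicit Arguments.
Unset Strict Implicit.
Unset Printing Implicit Defensive.

(** * Arcs of paths, of cycles and of the strip, over numbered vertices *)

Definition path_arcs (p : seq nat) : seq (nat * nat) := zip p (behead p).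

Definition cycle_arcs {T : Type} (c : seq T) : seq (T * T) := zip c (rot 1 c).

Definition shift_arc (k : nat) (a : nat * nat) : nat * nat := (k + a.1, k + a.2).

Definition both_ways (a : nat * nat) : seq (nat * nat) := [:: a; (a.2, a.1)].

(* The vertices x_i and y_i are coded by 2i and 2i+1. The edges of J are the
   translates by 2i, for i < m, of these edges, which join column 0 to a later
   column or lie inside column 1. *)
Definition base_edges : seq (nat * nat) :=
  [:: (2, 3); (0, 2); (1, 3); (0, 3); (1, 2); (0, 4); (1, 5); (0, 5); (1, 4)].

Definition step_arcs (i : nat) : seq (nat * nat) :=
  map (shift_arc (2 * i)) (flatten (map both_ways base_edges)).

Definition J_arcs (n : nat) : seq (nat * nat) := flatten (map step_arcs (iota 0 n)).

(** * Blocks and their verification by computation *)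

(* For each of the nine factors: the new cycles, then the vertices put before
   and after the open path of that factor.  Vertices are numbered from the
   first column of the block. *)
Definition block := seq (seq (seq nat) * (seq nat * seq nat)).

(* The tables below were found by a computer search.  The i-th entry of
   [closed_occ] (resp. [open_occ]) lists the vertices of the last two columns,
   numbered 0 to 3, that factor i occupies when no path (resp. one path) is
   open; [open_ends] gives the two ends of that path. *)
Definition closed_occ : seq (seq nat) :=
  [:: [:: 1];
      [::];
      [:: 1; 2];
      [:: 0; 1; 3];
      [:: 0; 1];
      [:: 2];
      [:: 0];
      [:: 0; 1; 3];
      [:: 0]].

Definition open_occ : seq (seq nat) :=
  [:: [:: 0; 2];
      [:: 0; 2];
      [:: 1; 3];
      [:: 0; 1];
      [:: 0; 1; 2];
      [:: 0; 1; 3];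
      [:: 0; 1; 3];
      [:: 0; 1; 3];
      [:: 0; 1; 2]].

Definition open_ends : seq (nat * nat) :=
  [:: (2, 0); (0, 2); (1, 3); (0, 1); (2, 0); (3, 1); (3, 0); (0, 3); (1, 2)].

(** The digits in the names of opening and closed blocks list the half-lengths of the cycles
    completed inside the block. In [close_block2] and [close_block3] the digit counts columns. *)
Definition open_block : block :=
  [:: ([::], ([:: 6; 3; 2; 0; 4], [::]));
      ([::], ([:: 4; 1; 3; 0; 2; 6], [::]));
      ([::], ([:: 5; 0; 3; 7], [::]));
      ([::], ([:: 4; 2; 5], [::]));
      ([::], ([:: 6; 2; 3; 5; 4], [::]));
      ([::], ([:: 7; 3; 1; 4; 0; 5], [::]));
      ([::], ([:: 7; 2; 1; 5; 3; 4], [::]));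
      ([::], ([:: 4; 5; 2; 7], [::]));
      ([::], ([:: 5; 1; 2; 4; 3; 6], [::]))].

Definition open_block1 : block :=
  [:: ([:: [:: 0; 2]], ([:: 8; 4; 3; 5; 6], [::]));
      ([:: [:: 0; 4]], ([:: 6; 3; 1; 2; 5; 8], [::]));
      ([:: [:: 0; 3]], ([:: 7; 5; 4; 9], [::]));
      ([:: [:: 2; 4]], ([:: 6; 5; 7], [::]));
      ([:: [:: 4; 7]], ([:: 8; 5; 3; 2; 6], [::]));
      ([:: [:: 0; 5]], ([:: 9; 4; 1; 3; 6; 7], [::]));
      ([:: [:: 3; 7]], ([:: 9; 5; 2; 1; 4; 6], [::]));
      ([:: [:: 2; 7]], ([:: 6; 4; 5; 9], [::]));
      ([:: [:: 1; 5]], ([:: 7; 6; 2; 3; 4; 8], [::]))].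

Definition open_block2 : block :=
  [:: ([:: [:: 0; 4; 6; 2]], ([:: 10; 7; 3; 5; 8], [::]));
      ([:: [:: 0; 2; 1; 4]], ([:: 8; 5; 3; 6; 7; 10], [::]));
      ([:: [:: 0; 5; 6; 3]], ([:: 9; 4; 7; 11], [::]));
      ([:: [:: 2; 6; 4; 5]], ([:: 8; 7; 9], [::]));
      ([:: [:: 2; 4; 3; 7]], ([:: 10; 6; 5; 9; 8], [::]));
      ([:: [:: 0; 3; 1; 5]], ([:: 11; 7; 6; 8; 4; 9], [::]));
      ([:: [:: 1; 2; 3; 4]], ([:: 11; 6; 9; 5; 7; 8], [::]));
      ([:: [:: 2; 7; 5; 4]], ([:: 8; 9; 6; 11], [::]));
      ([:: [:: 1; 3; 2; 5]], ([:: 9; 7; 4; 8; 6; 10], [::]))].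

Definition open_block11 : block :=
  [:: ([:: [:: 0; 2]; [:: 3; 4]], ([:: 10; 6; 5; 7; 8], [::]));
      ([:: [:: 0; 5]; [:: 1; 3]], ([:: 8; 4; 7; 2; 6; 10], [::]));
      ([:: [:: 0; 4]; [:: 3; 7]], ([:: 9; 5; 6; 11], [::]));
      ([:: [:: 2; 4]; [:: 6; 7]], ([:: 8; 5; 9], [::]));
      ([:: [:: 2; 3]; [:: 6; 9]], ([:: 10; 7; 5; 4; 8], [::]));
      ([:: [:: 0; 3]; [:: 1; 5]], ([:: 11; 6; 8; 7; 4; 9], [::]));
      ([:: [:: 1; 2]; [:: 3; 6]], ([:: 11; 7; 9; 4; 5; 8], [::]));
      ([:: [:: 2; 5]; [:: 4; 6]], ([:: 8; 9; 7; 11], [::]));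
      ([:: [:: 1; 4]; [:: 3; 5]], ([:: 9; 8; 6; 2; 7; 10], [::]))].

Definition loop_block : block :=
  [:: ([::], ([:: 6; 3; 1], [:: 4]));
      ([::], ([:: 4], [:: 1; 3; 6]));
      ([::], ([:: 5], [:: 0; 2; 7]));
      ([::], ([:: 4; 3; 2], [:: 5]));
      ([::], ([:: 6], [:: 3; 5; 4]));
      ([::], ([:: 7; 2], [:: 4; 5]));
      ([::], ([:: 7], [:: 5; 2; 4]));
      ([::], ([:: 4; 2; 5], [:: 7]));
      ([::], ([:: 5; 3; 4], [:: 6]))].

Definition close_block2 : block :=
  [:: ([::], ([::], [:: 3; 1; 5]));
      ([::], ([::], [:: 1; 3]));
      ([::], ([::], [:: 6; 2; 0; 5]));
      ([::], ([::], [:: 4; 2; 7; 3; 5]));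
      ([::], ([::], [:: 4; 5; 3]));
      ([::], ([::], [:: 2; 6]));
      ([::], ([::], [:: 2; 4]));
      ([::], ([::], [:: 7; 2; 5; 4]));
      ([::], ([::], [:: 3; 4]))].

Definition close_block3 : block :=
  [:: ([::], ([::], [:: 3; 1; 5; 7; 4]));
      ([::], ([::], [:: 5; 4; 1; 3]));
      ([::], ([::], [:: 7; 5; 8; 4; 0; 2]));
      ([::], ([::], [:: 2; 7; 3; 6; 4; 9; 5]));
      ([::], ([::], [:: 4; 7; 6; 5; 3]));
      ([::], ([::], [:: 4; 8; 5; 2]));
      ([::], ([::], [:: 5; 6; 2; 4]));
      ([::], ([::], [:: 5; 9; 4; 6; 7; 2]));
      ([::], ([::], [:: 6; 3; 4; 5]))].

Definition closed_block111 : block :=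
  [:: ([:: [:: 0; 2]; [:: 3; 5]; [:: 4; 7]], ([::], [::]));
      ([:: [:: 0; 5]; [:: 1; 3]; [:: 2; 4]], ([::], [::]));
      ([:: [:: 0; 4]; [:: 3; 7]; [:: 5; 8]], ([::], [::]));
      ([:: [:: 2; 5]; [:: 4; 9]; [:: 6; 7]], ([::], [::]));
      ([:: [:: 2; 6]; [:: 3; 4]; [:: 5; 7]], ([::], [::]));
      ([:: [:: 0; 3]; [:: 1; 5]; [:: 4; 8]], ([::], [::]));
      ([:: [:: 1; 4]; [:: 2; 3]; [:: 5; 6]], ([::], [::]));
      ([:: [:: 2; 7]; [:: 4; 6]; [:: 5; 9]], ([::], [::]));
      ([:: [:: 1; 2]; [:: 3; 6]; [:: 4; 5]], ([::], [::]))].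

Definition closed_block21 : block :=
  [:: ([:: [:: 0; 4; 3; 5]; [:: 2; 7]], ([::], [::]));
      ([:: [:: 1; 4; 5; 3]; [:: 0; 2]], ([::], [::]));
      ([:: [:: 0; 3; 7; 4]; [:: 5; 8]], ([::], [::]));
      ([:: [:: 2; 6; 7; 5]; [:: 4; 9]], ([::], [::]));
      ([:: [:: 2; 5; 7; 3]; [:: 4; 6]], ([::], [::]));
      ([:: [:: 0; 5; 1; 3]; [:: 4; 8]], ([::], [::]));
      ([:: [:: 1; 5; 4; 2]; [:: 3; 6]], ([::], [::]));
      ([:: [:: 2; 4; 7; 6]; [:: 5; 9]], ([::], [::]));
      ([:: [:: 1; 2; 3; 4]; [:: 5; 6]], ([::], [::]))].

Definition closed_block22 : block :=
  [:: ([:: [:: 0; 5; 3; 2]; [:: 4; 6; 7; 9]], ([::], [::]));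
      ([:: [:: 0; 2; 1; 5]; [:: 3; 7; 6; 4]], ([::], [::]));
      ([:: [:: 0; 3; 5; 4]; [:: 6; 9; 7; 10]], ([::], [::]));
      ([:: [:: 2; 7; 11; 6]; [:: 4; 5; 9; 8]], ([::], [::]));
      ([:: [:: 2; 3; 4; 7]; [:: 5; 8; 9; 6]], ([::], [::]));
      ([:: [:: 0; 4; 1; 3]; [:: 5; 6; 10; 7]], ([::], [::]));
      ([:: [:: 1; 4; 2; 5]; [:: 3; 6; 8; 7]], ([::], [::]));
      ([:: [:: 2; 4; 9; 5]; [:: 6; 11; 7; 8]], ([::], [::]));
      ([:: [:: 1; 2; 6; 3]; [:: 4; 8; 5; 7]], ([::], [::]))].

Definition closed_block222 : block :=
  [:: ([:: [:: 0; 2; 7; 3]; [:: 4; 9; 5; 6]; [:: 8; 13; 10; 11]], ([::], [::]));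
      ([:: [:: 0; 4; 1; 2]; [:: 3; 5; 8; 6]; [:: 7; 11; 10; 9]], ([::], [::]));
      ([:: [:: 0; 5; 3; 4]; [:: 6; 7; 8; 9]; [:: 10; 13; 11; 14]], ([::], [::]));
      ([:: [:: 2; 4; 5; 7]; [:: 6; 10; 15; 11]; [:: 8; 12; 13; 9]], ([::], [::]));
      ([:: [:: 2; 3; 6; 5]; [:: 4; 8; 10; 7]; [:: 9; 11; 13; 12]], ([::], [::]));
      ([:: [:: 0; 3; 1; 5]; [:: 4; 7; 6; 8]; [:: 9; 10; 14; 11]], ([::], [::]));
      ([:: [:: 1; 3; 7; 5]; [:: 2; 6; 9; 4]; [:: 8; 11; 12; 10]], ([::], [::]));
      ([:: [:: 2; 5; 4; 6]; [:: 7; 9; 13; 8]; [:: 10; 12; 11; 15]], ([::], [::]));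
      ([:: [:: 1; 4; 3; 2]; [:: 5; 9; 12; 8]; [:: 6; 11; 7; 10]], ([::], [::]))].

Definition closed_block221 : block :=
  [:: ([:: [:: 0; 2; 3; 4]; [:: 5; 8; 11; 9]; [:: 6; 7]], ([::], [::]));
      ([:: [:: 0; 3; 1; 2]; [:: 4; 6; 5; 7]; [:: 8; 9]], ([::], [::]));
      ([:: [:: 0; 5; 4; 3]; [:: 6; 8; 12; 9]; [:: 7; 11]], ([::], [::]));
      ([:: [:: 2; 4; 5; 6]; [:: 8; 13; 9; 11]; [:: 7; 10]], ([::], [::]));
      ([:: [:: 2; 7; 5; 3]; [:: 4; 8; 10; 9]; [:: 6; 11]], ([::], [::]));
      ([:: [:: 0; 4; 1; 5]; [:: 6; 9; 12; 8]; [:: 3; 7]], ([::], [::]));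
      ([:: [:: 1; 3; 5; 2]; [:: 4; 9; 7; 8]; [:: 6; 10]], ([::], [::]));
      ([:: [:: 2; 6; 4; 7]; [:: 5; 9; 13; 8]; [:: 10; 11]], ([::], [::]));
      ([:: [:: 1; 4; 2; 5]; [:: 7; 9; 10; 8]; [:: 3; 6]], ([::], [::]))].

Definition closed_block211 : block :=
  [:: ([:: [:: 5; 7; 6; 9]; [:: 0; 2]; [:: 3; 4]], ([::], [::]));
      ([:: [:: 0; 4; 7; 5]; [:: 1; 2]; [:: 3; 6]], ([::], [::]));
      ([:: [:: 0; 5; 9; 4]; [:: 3; 7]; [:: 6; 10]], ([::], [::]));
      ([:: [:: 6; 11; 7; 9]; [:: 2; 5]; [:: 4; 8]], ([::], [::]));
      ([:: [:: 2; 4; 9; 7]; [:: 3; 5]; [:: 6; 8]], ([::], [::]));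
      ([:: [:: 1; 4; 6; 5]; [:: 0; 3]; [:: 7; 10]], ([::], [::]));
      ([:: [:: 2; 6; 7; 4]; [:: 1; 3]; [:: 5; 8]], ([::], [::]));
      ([:: [:: 2; 7; 11; 6]; [:: 4; 5]; [:: 8; 9]], ([::], [::]));
      ([:: [:: 1; 5; 6; 4]; [:: 2; 3]; [:: 7; 8]], ([::], [::]))].

Definition closed_block2111 : block :=
  [:: ([:: [:: 5; 9; 11; 7]; [:: 0; 2]; [:: 3; 4]; [:: 6; 8]], ([::], [::]));
      ([:: [:: 2; 6; 3; 7]; [:: 0; 5]; [:: 1; 4]; [:: 8; 9]], ([::], [::]));
      ([:: [:: 6; 7; 8; 11]; [:: 0; 3]; [:: 4; 5]; [:: 9; 12]], ([::], [::]));
      ([:: [:: 7; 10; 11; 8]; [:: 2; 4]; [:: 5; 6]; [:: 9; 13]], ([::], [::]));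
      ([:: [:: 7; 11; 10; 9]; [:: 2; 3]; [:: 4; 6]; [:: 5; 8]], ([::], [::]));
      ([:: [:: 5; 7; 6; 9]; [:: 0; 4]; [:: 1; 3]; [:: 8; 12]], ([::], [::]));
      ([:: [:: 2; 7; 3; 6]; [:: 1; 5]; [:: 4; 9]; [:: 8; 10]], ([::], [::]));
      ([:: [:: 6; 11; 9; 10]; [:: 2; 5]; [:: 4; 7]; [:: 8; 13]], ([::], [::]));
      ([:: [:: 6; 10; 7; 9]; [:: 1; 2]; [:: 3; 5]; [:: 4; 8]], ([::], [::]))].

Definition closed_block3 : block :=
  [:: ([:: [:: 0; 5; 4; 7; 3; 2]], ([::], [::]));
      ([:: [:: 0; 2; 3; 4; 1; 5]], ([::], [::]));
      ([:: [:: 0; 3; 7; 5; 8; 4]], ([::], [::]));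
      ([:: [:: 2; 7; 6; 5; 9; 4]], ([::], [::]));
      ([:: [:: 2; 5; 7; 4; 3; 6]], ([::], [::]));
      ([:: [:: 0; 4; 8; 5; 1; 3]], ([::], [::]));
      ([:: [:: 1; 4; 6; 3; 5; 2]], ([::], [::]));
      ([:: [:: 2; 4; 9; 5; 6; 7]], ([::], [::]));
      ([:: [:: 1; 2; 6; 4; 5; 3]], ([::], [::]))].

Definition closed_block31 : block :=
  [:: ([:: [:: 3; 5; 4; 6; 9; 7]; [:: 0; 2]], ([::], [::]));
      ([:: [:: 1; 5; 7; 6; 3; 2]; [:: 0; 4]], ([::], [::]));
      ([:: [:: 0; 5; 9; 6; 4; 3]; [:: 7; 10]], ([::], [::]));
      ([:: [:: 2; 5; 6; 8; 9; 4]; [:: 7; 11]], ([::], [::]));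
      ([:: [:: 3; 4; 9; 8; 6; 5]; [:: 2; 7]], ([::], [::]));
      ([:: [:: 0; 3; 1; 4; 7; 5]; [:: 6; 10]], ([::], [::]));
      ([:: [:: 1; 3; 7; 8; 4; 5]; [:: 2; 6]], ([::], [::]));
      ([:: [:: 2; 4; 8; 7; 9; 5]; [:: 6; 11]], ([::], [::]));
      ([:: [:: 1; 2; 3; 6; 7; 4]; [:: 5; 8]], ([::], [::]))].

Definition closed_block32 : block :=
  [:: ([:: [:: 0; 3; 6; 11; 7; 2]; [:: 4; 8; 9; 5]], ([::], [::]));
      ([:: [:: 0; 2; 7; 3; 1; 5]; [:: 4; 9; 6; 8]], ([::], [::]));
      ([:: [:: 0; 5; 3; 7; 6; 4]; [:: 8; 12; 9; 11]], ([::], [::]));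
      ([:: [:: 2; 4; 7; 11; 6; 5]; [:: 8; 13; 9; 10]], ([::], [::]));
      ([:: [:: 2; 3; 5; 9; 4; 6]; [:: 7; 8; 11; 10]], ([::], [::]));
      ([:: [:: 5; 6; 7; 9; 12; 8]; [:: 0; 4; 1; 3]], ([::], [::]));
      ([:: [:: 1; 2; 6; 3; 4; 5]; [:: 7; 10; 9; 8]], ([::], [::]));
      ([:: [:: 6; 10; 11; 9; 13; 8]; [:: 2; 5; 7; 4]], ([::], [::]));
      ([:: [:: 5; 8; 10; 6; 9; 7]; [:: 1; 4; 3; 2]], ([::], [::]))].

Definition closed_block311 : block :=
  [:: ([:: [:: 2; 3; 5; 8; 7; 6]; [:: 0; 4]; [:: 9; 11]], ([::], [::]));
      ([:: [:: 4; 8; 6; 9; 5; 7]; [:: 0; 2]; [:: 1; 3]], ([::], [::]));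
      ([:: [:: 3; 7; 11; 8; 4; 6]; [:: 0; 5]; [:: 9; 12]], ([::], [::]));
      ([:: [:: 5; 9; 13; 8; 11; 6]; [:: 2; 4]; [:: 7; 10]], ([::], [::]));
      ([:: [:: 2; 6; 11; 7; 8; 5]; [:: 3; 4]; [:: 9; 10]], ([::], [::]));
      ([:: [:: 1; 4; 9; 6; 7; 5]; [:: 0; 3]; [:: 8; 12]], ([::], [::]));
      ([:: [:: 1; 2; 5; 3; 6; 4]; [:: 7; 9]; [:: 8; 10]], ([::], [::]));
      ([:: [:: 4; 5; 6; 8; 13; 9]; [:: 2; 7]; [:: 10; 11]], ([::], [::]));
      ([:: [:: 1; 5; 4; 7; 3; 2]; [:: 6; 10]; [:: 8; 9]], ([::], [::]))].

Definition occ (o : bool) (i : nat) : seq nat :=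
  nth [::] (if o then open_occ else closed_occ) i.

Definition first_end (i : nat) : nat := (nth (0, 0) open_ends i).1.
Definition last_end (i : nat) : nat := (nth (0, 0) open_ends i).2.

Definition bcycles (b : block) (i : nat) : seq (seq nat) := (nth ([::], ([::], [::])) b i).1.
Definition bprefix (b : block) (i : nat) : seq nat := (nth ([::], ([::], [::])) b i).2.1.
Definition bsuffix (b : block) (i : nat) : seq nat := (nth ([::], ([::], [::])) b i).2.2.

(** [o] and [o'] tell whether a path is open before and after the block. The old ends [h] and [t]
    are included because the prefix runs into [h] and the suffix leaves from [t]. When the path is
    closed, the defaults of [last] and [head] cover an empty suffix or prefix. *)
Definition new_arcs (o o' : bool) (b : block) (i : nat) : seq (nat * nat) :=
  let h := first_end i in let t := last_end i in
  flatten (map cycle_arcs (bcycles b i)) ++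
  (if o then path_arcs (rcons (bprefix b i) h) ++ path_arcs (t :: bsuffix b i) ++
             (if o' then [::] else [:: (last t (bsuffix b i), head h (bprefix b i))])
   else path_arcs (bprefix b i)).

(** A path that stays open must end at the translates of [open_ends] by [l] columns, where the next
    block expects it. A path opened in this block consists of its prefix alone. *)
Definition ends_ok (o o' : bool) (l : nat) (b : block) (i : nat) : bool :=
  let p := bprefix b i in let q := bsuffix b i in
  let h := first_end i in let t := last_end i in
  (o || nilp q) &&
  (if o' then
     [&& o || ~~ nilp p, head h p == 2 * l + h &
         last (if o then t else last t p) q == 2 * l + t]
   else o || nilp p).

(** There are nine factors because each column accounts for 9 edges, so that the strip has [18 * m]
    arcs, while a 2-regular digraph of order [2 * m] has [2 * m]. The last condition says that each
    factor fills the first [l] columns, given what it occupied there before, and leaves the next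
    block the same pattern of occupied vertices, translated. *)
Definition block_ok (o o' : bool) (l : nat) (lens : seq nat) (b : block) : bool :=
  perm_eq (flatten (map (new_arcs o o' b) (iota 0 9))) (J_arcs l) &&
  all (fun i =>
    [&& map size (bcycles b i) == lens, ends_ok o o' l b i &
        perm_eq (occ o i ++ flatten (bcycles b i) ++ bprefix b i ++ bsuffix b i)
                (iota 0 (2 * l) ++ map (addn (2 * l)) (occ o' i))])
    (iota 0 9).

Lemma open_block_ok : block_ok false true 2 [::] open_block.
Proof. by vm_compute. Qed.

Lemma open_block1_ok : block_ok false true 3 [:: 2] open_block1.
Proof. by vm_compute. Qed.

Lemma open_block2_ok : block_ok false true 4 [:: 4] open_block2.
Proof. by vm_compute. Qed.

Lemma open_block11_ok : block_ok false true 4 [:: 2; 2] open_block11.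
Proof. by vm_compute. Qed.

Lemma loop_block_ok : block_ok true true 2 [::] loop_block.
Proof. by vm_compute. Qed.

Lemma close_block2_ok : block_ok true false 2 [::] close_block2.
Proof. by vm_compute. Qed.

Lemma close_block3_ok : block_ok true false 3 [::] close_block3.
Proof. by vm_compute. Qed.

(** The keys are half-lengths: a cycle of length [2 * k] accounts for [k] columns, so the sum of a
    key is the number of columns of its block. *)
Definition closed_blocks : seq (seq nat * block) :=
  [:: ([:: 1; 1; 1], closed_block111); ([:: 2; 1], closed_block21);
      ([:: 2; 2], closed_block22); ([:: 2; 2; 2], closed_block222);
      ([:: 2; 2; 1], closed_block221); ([:: 2; 1; 1], closed_block211);
      ([:: 2; 1; 1; 1], closed_block2111); ([:: 3], closed_block3);
      ([:: 3; 1], closed_block31); ([:: 3; 2], closed_block32);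
      ([:: 3; 1; 1], closed_block311)].

Lemma closed_blocks_ok :
  all (fun kb => block_ok false false (sumn kb.1) (map double kb.1) kb.2) closed_blocks.
Proof. by vm_compute. Qed.

(** * Translating, splitting and closing paths *)

Lemma zip_map2 (S1 S2 T1 T2 : Type) (f : S1 -> T1) (g : S2 -> T2) (s : seq S1) (t : seq S2) :
  zip (map f s) (map g t) = map (fun a => (f a.1, g a.2)) (zip s t).
Proof. by elim: s t => [|x s IHs] [|y t] //=; rewrite IHs. Qed.

Lemma cycle_arcs_map (T1 T2 : Type) (f : T1 -> T2) (c : seq T1) :
  cycle_arcs (map f c) = map (fun a => (f a.1, f a.2)) (cycle_arcs c).
Proof. by rewrite /cycle_arcs -map_rot zip_map2. Qed.

Lemma path_arcs_shift (k : nat) (p : seq nat) :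
  path_arcs (map (addn k) p) = map (shift_arc k) (path_arcs p).
Proof. by rewrite /path_arcs behead_map zip_map2. Qed.

Lemma shift_arcD (k l : nat) (s : seq (nat * nat)) :
  map (shift_arc (k + l)) s = map (shift_arc k) (map (shift_arc l) s).
Proof. by rewrite -map_comp; apply: eq_map => -[u v]; rewrite /shift_arc /= !addnA. Qed.

(** Every step is a translate of the first one. This is why a block checked once at the origin can
    be glued on after any number of columns. *)
Lemma J_arcsD (n l : nat) :
  J_arcs (n + l) = J_arcs n ++ map (shift_arc (2 * n)) (J_arcs l).
Proof.
rewrite /J_arcs iotaD map_cat flatten_cat add0n -[X in iota X l]addn0 iotaDl.
rewrite map_flatten -!map_comp; congr (_ ++ flatten _); apply: eq_map => i /=.
by rewrite /step_arcs mulnDr shift_arcD.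
Qed.

Lemma path_arcs_cat (p q : seq nat) (x : nat) :
  path_arcs (p ++ x :: q) = path_arcs (rcons p x) ++ path_arcs (x :: q).
Proof.
rewrite /path_arcs; elim: p => [|y p IHp] //=.
by case: p IHp => [|z p] //= ->.
Qed.

(** The old path [x :: p] is extended on both sides. Each new piece is taken together with the old
    end that it is attached to, as in [new_arcs]. *)
Lemma path_arcs_splice (p1 p p2 : seq nat) (x : nat) :
  path_arcs (p1 ++ (x :: p) ++ p2) =
  path_arcs (rcons p1 x) ++ path_arcs (x :: p) ++ path_arcs (last x p :: p2).
Proof.
rewrite path_arcs_cat -cat_cons; case: (lastP p) => [|p' y] /=.
  by [].
by rewrite last_rcons cat_rcons -cat_cons path_arcs_cat rcons_cons.
Qed.

Lemma cycle_arcs_path (x : nat) (p : seq nat) :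
  cycle_arcs (x :: p) = path_arcs (x :: p) ++ [:: (last x p, x)].
Proof.
rewrite /cycle_arcs /path_arcs rot1_cons /=.
suff zipE z : zip (z :: p) (rcons p x) = zip (z :: p) p ++ [:: (last z p, x)] by apply: zipE.
by elim: p z => [|y p IHp] z //=; rewrite IHp.
Qed.

Lemma cycle_arcs_closing (p1 p p2 : seq nat) (x : nat) :
  cycle_arcs (p1 ++ (x :: p) ++ p2) =
  path_arcs (p1 ++ (x :: p) ++ p2) ++
  [:: (last (last x p) p2, head x p1)].
Proof.
by case: p1 => [|y p1] /=; rewrite cycle_arcs_path ?last_cat /= ?last_cat.
Qed.

(** * Gluing a block to a partial decomposition *)

Definition factor := (seq (seq nat) * seq nat)%type.

Definition factor_arcs (f : factor) : seq (nat * nat) :=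
  flatten (map cycle_arcs f.1) ++ path_arcs f.2.

(* [occ false i] is listed among the vertices of factor [i]: these vertices of
   the first two columns are reserved, as the factor will use their images in
   the last two columns instead. *)
Record partial_decomp (o : bool) (n : nat) (s : seq nat) (D : nat -> factor) : Prop :=
  PartialDecomp {
    pd_arcs : perm_eq (flatten (map (factor_arcs \o D) (iota 0 9))) (J_arcs n);
    pd_sizes : forall i, i < 9 -> perm_eq (map size (D i).1) s;
    pd_verts : forall i, i < 9 ->
      perm_eq (flatten (D i).1 ++ (D i).2 ++ occ false i)
              (iota 0 (2 * n) ++ map (addn (2 * n)) (occ o i));
    pd_ends : forall i, i < 9 ->
      if o then exists2 p, (D i).2 = 2 * n + first_end i :: p &
                           last (2 * n + first_end i) p = 2 * n + last_end i
      else (D i).2 = [::] }.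

Definition extend (closing : bool) (n : nat) (b : block) (D : nat -> factor)
    (i : nat) : factor :=
  let cs := map (map (addn (2 * n))) (bcycles b i) ++ (D i).1 in
  let p := map (addn (2 * n)) (bprefix b i) ++ (D i).2 ++
           map (addn (2 * n)) (bsuffix b i) in
  if closing then (p :: cs, [::]) else (cs, p).

Lemma perm_flatten_cat (I : eqType) (T : eqType) (f g h : I -> seq T) (r : seq I) :
  {in r, forall i, perm_eq (f i) (g i ++ h i)} ->
  perm_eq (flatten (map f r)) (flatten (map g r) ++ flatten (map h r)).
Proof.
elim: r => [|i r IHr] //= fgh; rewrite -catA.
have fghi := fgh i (mem_head i r).
have {IHr} IHr := IHr (fun j rj => fgh j (mem_behead (s := i :: r) rj)).
by rewrite (perm_trans (perm_cat fghi IHr)) // -catA perm_cat2l perm_catCA.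
Qed.

Lemma extend_arcs (o o' : bool) (n l : nat) (s : seq nat) (b : block)
    (D : nat -> factor) (i : nat) :
  partial_decomp o n s D -> i < 9 -> ends_ok o o' l b i ->
  perm_eq (factor_arcs (extend (o && ~~ o') n b D i))
          (factor_arcs (D i) ++ map (shift_arc (2 * n)) (new_arcs o o' b i)).
Proof.
move=> pdD i9; have := pd_ends pdD i9; rewrite /ends_ok /factor_arcs /extend /new_arcs.
set cs := bcycles b i; set p1 := bprefix b i; set p2 := bsuffix b i.
set k := 2 * n; set h := first_end i; set t := last_end i.
have arcs_cs : flatten (map cycle_arcs (map (map (addn k)) cs)) =
    map (shift_arc k) (flatten (map cycle_arcs cs)).
  rewrite map_flatten -!map_comp; congr flatten; apply: eq_map => c /=.
  exact: cycle_arcs_map.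
case: o pdD => pdD /=.
  move=> [p -> lastp] _.
  have arcs_p1 : path_arcs (rcons (map (addn k) p1) (k + h)) =
      map (shift_arc k) (path_arcs (rcons p1 h)).
    by rewrite -path_arcs_shift map_rcons.
  have arcs_p2 : path_arcs ((k + t) :: map (addn k) p2) =
      map (shift_arc k) (path_arcs (t :: p2)) by rewrite -path_arcs_shift.
  case: o' => /=.
    rewrite map_cat flatten_cat arcs_cs (path_arcs_splice _ p) lastp arcs_p1 arcs_p2.
    by apply/permP => a; rewrite !(map_cat, count_cat) /=; lia.
  rewrite (cycle_arcs_closing _ p) map_cat flatten_cat arcs_cs (path_arcs_splice _ p).
  rewrite lastp arcs_p1 arcs_p2 last_map.
  have -> : head (k + h) (map (addn k) p1) = k + head h p1 by case: (p1).
  rewrite -[(_, k + head h p1)]/(shift_arc k (last t p2, head h p1)).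
  by apply/permP => a; rewrite !(map_cat, count_cat) /=; lia.
move=> -> /andP[/nilP-> _]; rewrite /= cats0 map_cat flatten_cat arcs_cs path_arcs_shift.
by apply/permP => a; rewrite !(map_cat, count_cat) /=; lia.
Qed.

Lemma map_addnD (k l : nat) (s : seq nat) :
  map (addn (k + l)) s = map (addn k) (map (addn l) s).
Proof. by rewrite -map_comp; apply: eq_map => x /=; rewrite addnA. Qed.

(** The lengths of the open paths differ between factors and are not tracked. A cycle being closed
    takes whatever the other cycles leave of the [2 * (n + l)] vertices, so its length is the same
    in all nine factors. *)
Lemma partial_decomp_extend (o o' : bool) (n l : nat) (s lens : seq nat) (b : block)
    (D : nat -> factor) :
  partial_decomp o n s D -> block_ok o o' l lens b ->
  partial_decomp o' (n + l)
    ((if o && ~~ o' then [:: 2 * (n + l) - sumn (lens ++ s)] else [::]) ++ lens ++ s)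
    (extend (o && ~~ o') n b D).
Proof.
move=> pdD /andP[b_arcs /allP b_ok].
have {}b_ok i : i < 9 -> [/\ map size (bcycles b i) = lens, ends_ok o o' l b i &
    perm_eq (occ o i ++ flatten (bcycles b i) ++ bprefix b i ++ bsuffix b i)
            (iota 0 (2 * l) ++ map (addn (2 * l)) (occ o' i))].
  by move=> i9; have /b_ok/and3P[/eqP] : i \in iota 0 9 by rewrite mem_iota.
have verts i : i < 9 ->
    perm_eq (flatten (extend (o && ~~ o') n b D i).1 ++
               (extend (o && ~~ o') n b D i).2 ++ occ false i)
            (iota 0 (2 * (n + l)) ++ map (addn (2 * (n + l))) (occ o' i)).
  move=> i9; have [_ _ verts_b] := b_ok i i9; have verts_D := pd_verts pdD i9.
  have := perm_map (addn (2 * n)) verts_b; rewrite !map_cat -map_addnD => {}verts_b.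
  have flat_cs : flatten (map (map (addn (2 * n))) (bcycles b i)) =
      map (addn (2 * n)) (flatten (bcycles b i)) by rewrite map_flatten.
  rewrite mulnDr iotaD add0n -[X in iota X (2 * l)]addn0 iotaDl.
  (* The translate of [occ o i] is on the right-hand side for [D] and on the left-hand side for the
     block, so it cancels when occurrences are counted. *)
  apply/permP => a; move/permP: verts_b => /(_ a); move/permP: verts_D => /(_ a).
  rewrite /extend; case: ifP => _ /=; rewrite !(flatten_cat, flat_cs, count_cat) /=;
    lia.
have sizes_cs i : i < 9 -> perm_eq
    (map size (map (map (addn (2 * n))) (bcycles b i) ++ (D i).1)) (lens ++ s).
  move=> i9; have [<- _ _] := b_ok i i9.
  rewrite map_cat -map_comp (eq_map (fun c => size_map (addn (2 * n)) c)).
  by rewrite perm_cat2l (pd_sizes pdD i9).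
split=> //.
- rewrite J_arcsD.
  have arcs_nb := perm_cat (pd_arcs pdD) (perm_map (shift_arc (2 * n)) b_arcs).
  rewrite -(permPr arcs_nb).
  rewrite map_flatten -map_comp {arcs_nb}.
  apply: perm_flatten_cat => i; rewrite mem_iota => /= i9.
  by have [_ ends_b _] := b_ok i i9; exact: (extend_arcs pdD i9 ends_b).
- move=> i i9; have := sizes_cs i i9; have := perm_size (verts i i9).
  have := pd_ends pdD i9; have [_ /andP[+ _] _] := b_ok i i9.
  rewrite /extend; case: o o' {b_arcs b_ok verts sizes_cs pdD} => -[] //=.
  move=> _ _; set p := map _ _ ++ _ ++ _; set cs := map _ _ ++ _ => sz perm_cs.
  have sz_cs : size (flatten cs) = sumn (lens ++ s).
    by rewrite size_flatten /shape (perm_sumn perm_cs).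
  suff -> : 2 * (n + l) - sumn (lens ++ s) = size p by rewrite perm_cons.
  by move: sz; rewrite -sz_cs !size_cat /= !size_map size_iota; lia.
- move=> i i9; have := pd_ends pdD i9; have [_ + _] := b_ok i i9.
  rewrite /ends_ok /extend; set p1 := bprefix b i; set p2 := bsuffix b i.
  case: o o' {b_arcs b_ok verts sizes_cs pdD} => -[] //=.
  + move=> /andP[/eqP hd /eqP lt] [p -> lastp].
    (* With an empty prefix [head] returns the old end itself, which forces [l = 0]. *)
    case: (p1) hd => [|x p1'] /= hd.
      exists (p ++ map (addn (2 * n)) p2); first by congr (_ :: _); lia.
      have -> : 2 * (n + l) + first_end i = 2 * n + first_end i by lia.
      by rewrite last_cat lastp last_map lt; lia.
    exists (map (addn (2 * n)) p1' ++ (2 * n + first_end i :: p) ++ map (addn (2 * n)) p2).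
      by congr (_ :: _); lia.
    by rewrite last_cat /= last_cat lastp last_map lt; lia.
  + move=> /andP[/nilP-> /and3P[p1n /eqP hd /eqP lt]] ->; rewrite !cats0.
    case: (p1) p1n hd lt => [|x p1'] //= _ hd lt; exists (map (addn (2 * n)) p1').
      by congr (_ :: _); lia.
    by rewrite mulnDr -addnA -hd last_map lt; lia.
  + by move=> /andP[/nilP-> /nilP->] ->.
Qed.

(** * Even cycle types that can be assembled from blocks *)

Definition decomposable (ks : seq nat) : Prop :=
  exists D, partial_decomp false (sumn ks) (map double ks) D.

Lemma sumn_map_double (ks : seq nat) : sumn (map double ks) = 2 * sumn ks.
Proof. by elim: ks => [|k ks IHks] //=; rewrite IHks; lia. Qed.

Lemma decomposable_nil : decomposable [::].
Proof.
exists (fun=> ([::], [::])); split=> // i _.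
by rewrite /= map_id.
Qed.

Lemma decomposable_perm (ks ks' : seq nat) :
  perm_eq ks ks' -> decomposable ks -> decomposable ks'.
Proof.
move=> eq_ks [D [arcsD sizesD vertsD endsD]]; exists D.
rewrite -(perm_sumn eq_ks); split=> // i i9.
by rewrite (perm_trans (sizesD i i9)) ?perm_map.
Qed.

Lemma decomposable_closed (b ks : seq nat) :
  b \in unzip1 closed_blocks -> decomposable ks -> decomposable (b ++ ks).
Proof.
move=> /mapP[[b' blk] b_blk ->] [D pdD].
have /= blk_ok := allP closed_blocks_ok _ b_blk.
exists (extend false (sumn ks) blk D).
by rewrite sumn_cat addnC map_cat; apply: (partial_decomp_extend pdD blk_ok).
Qed.

Lemma partial_decomp_loop (n j : nat) (s : seq nat) (D : nat -> factor) :
  partial_decomp true n s D ->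
  exists D', partial_decomp true (n + 2 * j) s D'.
Proof.
move=> pdD; elim: j => [|j [D' pdD']]; first by exists D; rewrite addn0.
have := partial_decomp_extend pdD' loop_block_ok => /= pdD''.
by exists (extend false (n + 2 * j) loop_block D'); rewrite mulnS addnCA addnC.
Qed.

(** The long cycle accounts for [k] columns: 2 in the opening block beyond those of [b], 2 in each
    of [k./2 - 2] loop blocks, and [2 + odd k] in the closing block. Opening and closing together
    need [4 <= k]. *)
Lemma decomposable_long (k : nat) (b ks : seq nat) :
  4 <= k -> b \in [:: [::]; [:: 1]; [:: 2]; [:: 1; 1]] ->
  decomposable ks -> decomposable (k :: b ++ ks).
Proof.
move=> k4 b_in [D pdD].
have [blk blk_ok] : exists blk, block_ok false true (2 + sumn b) (map double b) blk.
  move: b_in; rewrite !inE => /or4P[] /eqP->.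
  - by exists open_block; apply: open_block_ok.
  - by exists open_block1; apply: open_block1_ok.
  - by exists open_block2; apply: open_block2_ok.
  - by exists open_block11; apply: open_block11_ok.
have [blk' blk'_ok] : exists blk', block_ok true false (2 + odd k) [::] blk'.
  case: (odd k).
  - by exists close_block3; apply: close_block3_ok.
  - by exists close_block2; apply: close_block2_ok.
have pd1 := partial_decomp_extend pdD blk_ok.
have [D2 pd2] := partial_decomp_loop (k./2 - 2) pd1.
have := partial_decomp_extend pd2 blk'_ok; rewrite /= => pd3.
exists (extend true (sumn ks + (2 + sumn b) + 2 * (k./2 - 2)) blk' D2).
have k_half := odd_double_half k.
have n_eq : sumn ks + (2 + sumn b) + 2 * (k./2 - 2) + (2 + odd k) = sumn (k :: b ++ ks).
  by rewrite /= sumn_cat; lia.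
move: pd3; rewrite n_eq -map_cat sumn_map_double /=.
by have -> : 2 * (k + sumn (b ++ ks)) - 2 * sumn (b ++ ks) = k.*2 by lia.
Qed.

(** Half-length 3 is too short for an opening and a closing block. The four keys of [closed_blocks]
    that begin with 3 replace them, one for each choice of [b]. *)
Lemma decomposable_ge3 (k : nat) (b ks : seq nat) :
  3 <= k -> b \in [:: [::]; [:: 1]; [:: 2]; [:: 1; 1]] ->
  decomposable ks -> decomposable (k :: b ++ ks).
Proof.
rewrite leq_eqVlt => /orP[/eqP<-|k4]; last exact: decomposable_long.
move=> b_in; rewrite -cat_cons; apply: decomposable_closed.
by move: b_in; rewrite !inE => /or4P[] /eqP->.
Qed.

Definition ones_twos (a b : nat) : seq nat := nseq a 1 ++ nseq b 2.

(** Quantifying over [ks] lets groups of 2-cycles and 4-cycles be glued on one after another, which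
    gives additivity in [(a, b)]. *)
Definition absorbable (a b : nat) : Prop :=
  forall ks, decomposable ks -> decomposable (ones_twos a b ++ ks).

Lemma absorbableD (a b a' b' : nat) :
  absorbable a b -> absorbable a' b' -> absorbable (a + a') (b + b').
Proof.
move=> abs abs' ks ksD; apply: (decomposable_perm _ (abs _ (abs' _ ksD))).
by apply/permP => p; rewrite /ones_twos !nseqD !count_cat; lia.
Qed.

Lemma absorbable_closed (a b : nat) :
  nseq b 2 ++ nseq a 1 \in unzip1 closed_blocks -> absorbable a b.
Proof.
move=> ab_in ks ksD; apply: (decomposable_perm _ (decomposable_closed ab_in ksD)).
by rewrite perm_cat2r perm_catC.
Qed.

(** By induction on [a + b], one of the groups [(3, 0)], [(1, 1)], [(0, 2)] is split off so that the
    rest keeps a 4-cycle and still satisfies the bound. The pairs [(0, 2)], [(0, 3)], [(1, 1)],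
    [(1, 2)], [(2, 1)] and [(3, 1)] are the base cases, each with its own closed block. *)
Lemma absorbable_ones_twos (a b : nat) : 0 < b -> 3 <= a + 2 * b -> absorbable a b.
Proof.
have abs30 : absorbable 3 0 by apply: absorbable_closed.
have abs11 : absorbable 1 1 by apply: absorbable_closed.
have abs02 : absorbable 0 2 by apply: absorbable_closed.
have abs21 : absorbable 2 1 by apply: absorbable_closed.
have abs12 : absorbable 1 2 by apply: absorbable_closed.
have [N] := ubnP (a + b); elim: N a b => // N IHN a b leN b0 ab3.
have split_off a' b' : absorbable a' b' -> 0 < a' + b' -> a' <= a -> b' < b ->
    3 <= (a - a') + 2 * (b - b') -> absorbable a b.
  move=> abs' ab' lea ltb le3; rewrite -(subnKC lea) -(subnKC (ltnW ltb)).
  by apply: absorbableD => //; apply: IHN => //; lia.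
case: a leN ab3 split_off => [|[|a]] leN ab3 split_off.
- case: b b0 leN ab3 split_off => [|[|[|[|b]]]] // _ leN ab3 split_off.
    by apply: absorbable_closed.
  by apply: (split_off 0 2); rewrite //; lia.
- case: b b0 leN ab3 split_off => [|[|[|b]]] // _ leN ab3 split_off.
  by apply: (split_off 0 2); rewrite //; lia.
- case: b b0 leN ab3 split_off => [|[|b]] // _ leN ab3 split_off; last first.
    by apply: (split_off 1 1); rewrite //; lia.
  case: a leN ab3 split_off => [|[|a]] // leN ab3 split_off.
    by apply: absorbable_closed.
  by apply: (split_off 3 0); rewrite //; lia.
Qed.

(** Short cycles not covered by [absorbable_ones_twos] are a single 4-cycle, or 2-cycles alone, or
    none. The 4-cycle joins the long cycle as its [b]; 2-cycles are removed in threes, and the one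
    or two that may remain join the long cycle. *)
Lemma decomposable_ones_twos_long (a b k : nat) (ks : seq nat) :
  3 <= k -> decomposable ks -> decomposable (ones_twos a b ++ k :: ks).
Proof.
move=> k3 ksD.
have [/andP[b0 ab3]|] := boolP ((0 < b) && (3 <= a + 2 * b)).
  by apply: absorbable_ones_twos => //; apply: (decomposable_ge3 k3 (b := [::])).
rewrite negb_and => ab_small.
have [[-> ->]|b0] : (a = 0 /\ b = 1) \/ b = 0 by lia.
  apply: (decomposable_perm _ (decomposable_ge3 k3 (b := [:: 2]) isT ksD)).
  by apply/permP => p /=; lia.
rewrite b0 {b b0 ab_small}.
elim/ltn_ind: a => -[|[|[|a]]] IHa.
- exact: (decomposable_ge3 k3 (b := [::])).
- apply: (decomposable_perm _ (decomposable_ge3 k3 (b := [:: 1]) isT ksD)).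
  by apply/permP => p /=; lia.
- apply: (decomposable_perm _ (decomposable_ge3 k3 (b := [:: 1; 1]) isT ksD)).
  by apply/permP => p /=; lia.
- by apply: (decomposable_closed (b := [:: 1; 1; 1])) => //; apply: IHa; lia.
Qed.

Lemma perm_ones_twos (ks : seq nat) :
  all (leq 1) ks ->
  perm_eq ks (ones_twos (count_mem 1 ks) (count_mem 2 ks) ++ filter (leq 3) ks).
Proof.
elim: ks => [|k ks IHks] //= /andP[k0 /IHks/permP{}IHks]; apply/permP => p.
have := IHks p; rewrite /ones_twos /= !count_cat /= => ->.
have [->|k1] := eqVneq k 1; first by rewrite !nseqD !count_cat /=; lia.
have [->|k2] := eqVneq k 2; first by rewrite !nseqD !count_cat /=; lia.
have -> : 2 < k by lia.
by rewrite /= !add0n; lia.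
Qed.

(** If some half-length is at least 3, one such cycle takes care of all short ones and the other
    long cycles are built one by one. Otherwise there is a 4-cycle, since not all cycles are
    2-cycles, and everything is absorbed into the empty strip. *)
Lemma decomposable_all (ks : seq nat) :
  all (leq 1) ks -> 3 <= sumn ks -> ~~ all (pred1 1) ks -> decomposable ks.
Proof.
move=> ks_pos; have := perm_ones_twos ks_pos.
set a := count_mem 1 ks; set b := count_mem 2 ks; set ls := filter _ ks.
have ls3 : all (leq 3) ls by apply: filter_all.
move=> eq_ks; rewrite (perm_sumn eq_ks) (perm_all _ eq_ks) => sum3 not1.
rewrite perm_sym in eq_ks; apply: (decomposable_perm eq_ks).
have lsD (l : seq nat) : all (leq 3) l -> decomposable l.
  elim: l => [|k l IHl] /=; first by move=> _; apply: decomposable_nil.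
  by case/andP=> k3 /IHl; apply: (decomposable_ge3 k3 (b := [::])).
case: ls ls3 sum3 not1 {eq_ks} => [|k ls] /=.
  rewrite cats0 /ones_twos sumn_cat !sumn_nseq mul1n all_cat !all_nseq orbT /=.
  move=> _ sum3; rewrite orbF -lt0n => b0.
  by have := absorbable_ones_twos b0 sum3 decomposable_nil; rewrite cats0.
by case/andP=> k3 ls3 _ _; apply: decomposable_ones_twos_long => //; apply: lsD.
Qed.

(** * Cycle types determine 2-regular digraphs up to isomorphism *)

Lemma cycle_arcs_next (T : eqType) (c : seq T) :
  uniq c -> cycle_arcs c = [seq (x, next c x) | x <- c].
Proof.
case: c => // y c uniq_c; apply: (@eq_from_nth _ (y, y)).
  by rewrite size_map size_zip size_rot minnn.
move=> i; rewrite size_zip size_rot minnn => lt_i.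
rewrite nth_zip ?size_rot // (nth_map y) // next_nth mem_nth // index_uniq //.
congr (_, _); rewrite rot1_cons nth_rcons; case: ltnP => // le_i.
by rewrite if_same nth_default.
Qed.

Lemma mem_cycle_arcs (T : finType) (cs : seq (seq T)) :
  uniq (flatten cs) ->
  [set a | has (fun c => (a.1 \in c) && (a.2 == next c a.1)) cs] =
  [set a in flatten (map cycle_arcs cs)].
Proof.
move=> uniq_cs; apply/setP => -[u v]; rewrite !inE /=.
elim: cs uniq_cs => //= c cs IHcs; rewrite cat_uniq => /and3P[uniq_c _ /IHcs->].
rewrite mem_cat cycle_arcs_next //; congr (_ || _).
by apply/andP/mapP => [[uc /eqP->]|[x xc [-> ->]]]; [exists u | rewrite xc].
Qed.

Lemma has_cycle_typeP (T : finType) (D : digraph T) (s : seq nat) :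
  has_cycle_type D s <->
  exists cs : seq (seq T),
    [/\ perm_eq (map size cs) s, all (fun c => 2 <= size c) cs, uniq (flatten cs),
        verts D = [set v in flatten cs] &
        arcs D = [set a in flatten (map cycle_arcs cs)]].
Proof.
by split=> -[cs [perm_cs size_cs uniq_cs vertsD arcsD]]; exists cs;
  split=> //; rewrite arcsD mem_cycle_arcs.
Qed.

Lemma has_cycle_type_dorder (T : finType) (D : digraph T) (s : seq nat) :
  has_cycle_type D s -> dorder D = sumn s.
Proof.
move=> [cs [perm_cs _ uniq_cs vertsD _]].
by rewrite /dorder vertsD cardsE (card_uniqP uniq_cs) size_flatten (perm_sumn perm_cs).
Qed.

Lemma flatten_cycle_arcs_map (T1 T2 : Type) (f : T1 -> T2) (cs : seq (seq T1)) :
  flatten (map cycle_arcs (map (map f) cs)) =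
  map (fun a => (f a.1, f a.2)) (flatten (map cycle_arcs cs)).
Proof.
by rewrite map_flatten -!map_comp; congr flatten; apply: eq_map => c /=;
  apply: cycle_arcs_map.
Qed.

Lemma mem_zip (T1 T2 : eqType) (s : seq T1) (t : seq T2) (x : T1) (y : T2) :
  (x, y) \in zip s t -> (x \in s) && (y \in t).
Proof.
elim: s t => [|x' s IHs] [|y' t] //=; rewrite !inE xpair_eqE.
by case/orP=> [/andP[-> ->] //|/IHs/andP[-> ->]]; rewrite !orbT.
Qed.

Lemma mem_flatten_cycle_arcs (T : eqType) (cs : seq (seq T)) (u v : T) :
  (u, v) \in flatten (map cycle_arcs cs) -> (u \in flatten cs) && (v \in flatten cs).
Proof.
elim: cs => //= c cs IHcs; rewrite !mem_cat => /orP[|/IHcs/andP[-> ->]]; last first.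
  by rewrite !orbT.
by move=> /mem_zip/andP[-> /=]; rewrite mem_rot => ->.
Qed.

Lemma perm_sizes_rearrange (T : eqType) (cs : seq (seq T)) (s : seq nat) :
  perm_eq (map size cs) s ->
  exists2 cs', perm_eq cs' cs & map size cs' = s.
Proof.
rewrite perm_sym => /(perm_iotaP 0)[js perm_js ->].
rewrite size_map in perm_js; exists (map (nth [::] cs) js).
  by rewrite -[X in perm_eq _ X](mkseq_nth [::]) perm_map.
rewrite -map_comp; apply/eq_in_map => i; rewrite (perm_mem perm_js) mem_iota /= => lt_i.
by rewrite (nth_map [::]).
Qed.

(** Once the cycles of [D2] are reordered so that their sizes agree with those of [D1] one by one,
    matching the flattened vertex lists entry by entry carries each cycle to a cycle. The vertex
    [x2] is the default value for [nth]. *)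
Lemma isomorphic_cycle_type (T1 T2 : finType) (D1 : digraph T1) (D2 : digraph T2)
    (s : seq nat) (x2 : T2) :
  has_cycle_type D1 s -> has_cycle_type D2 s -> isomorphic D1 D2.
Proof.
move=> /has_cycle_typeP[cs1 [perm_cs1 _ uniq_cs1 verts1 arcs1]].
move=> /has_cycle_typeP[cs2 [perm_cs2 _ uniq_cs2 verts2 arcs2]].
have [cs perm_cs size_cs] : exists2 cs, perm_eq cs cs2 & map size cs = map size cs1.
  by apply: perm_sizes_rearrange; rewrite // (permPl perm_cs2) perm_sym.
have perm_flat : perm_eq (flatten cs) (flatten cs2) by apply: perm_flatten.
have size_flat : size (flatten cs) = size (flatten cs1).
  by rewrite !size_flatten /shape size_cs.
pose f x := nth x2 (flatten cs) (index x (flatten cs1)).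
have map_f : map f (flatten cs1) = flatten cs.
  case E : (flatten cs1) => [|x1 r]; first by move: size_flat; rewrite E => /size0nil->.
  rewrite -E; apply: (@eq_from_nth _ x2); rewrite size_map ?size_flat // => i lt_i.
  by rewrite (nth_map x1) // /f index_uniq.
have cs_f : cs = map (map f) cs1.
  (* A list of cycles is determined by its flattening and its sizes. *)
  rewrite -[LHS]flattenK -[RHS]flattenK -map_flatten map_f; congr (reshape _ _).
  by rewrite /shape size_cs -map_comp; apply: eq_map => c /=; rewrite size_map.
have f_inj : {in flatten cs1 &, injective f}.
  move=> u v ucs1 vcs1 /eqP; rewrite /f nth_uniq ?size_flat ?index_mem //.
    by move=> /eqP; apply: index_inj.
  by rewrite (perm_uniq perm_flat).
exists f; split.
- by move=> u v; rewrite verts1 !inE; apply: f_inj.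
- apply/setP => v; rewrite verts1 verts2 inE -(perm_mem perm_flat) -map_f.
  by apply/imsetP/mapP => -[u u_in ->]; exists u; move: u_in; rewrite ?inE.
move=> u v; rewrite verts1 !inE => u1 v1; rewrite arcs1 arcs2 !inE.
have -> : ((f u, f v) \in flatten (map cycle_arcs cs2)) =
    ((f u, f v) \in flatten (map cycle_arcs cs)).
  by apply: perm_mem; rewrite perm_sym; apply/perm_flatten/perm_map.
rewrite cs_f flatten_cycle_arcs_map; apply/mapP/idP => [[[u' v'] uv' [fu fv]]|uv].
  have /andP[u'1 v'1] := mem_flatten_cycle_arcs uv'.
  by rewrite (f_inj u u') // (f_inj v v').
by exists (u, v).
Qed.

(** * The numbered strip and the graph J *)

Lemma J_arcsP (n : nat) (a : nat * nat) :
  reflect (exists i e, [/\ i < n, e \in base_edges &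
             a = shift_arc (2 * i) e \/ a = shift_arc (2 * i) (e.2, e.1)])
          (a \in J_arcs n).
Proof.
apply: (iffP flattenP) => [[_ /mapP[i i_n ->] /mapP[e /flattenP[_ /mapP[e' e'_in ->]]]]|].
  rewrite mem_iota in i_n; rewrite !inE => e_e' ->; exists i, e'; split=> //.
  by case/orP: e_e' => /eqP->; [left | right].
move=> [i [e [lt_in e_in a_e]]]; exists (step_arcs i); first by rewrite map_f ?mem_iota.
by case: a_e => ->; apply: map_f; apply/flattenP; exists (both_ways e);
  rewrite ?map_f // !inE eqxx ?orbT.
Qed.

Lemma J_arcs_bound (n : nat) (a : nat * nat) :
  a \in J_arcs n -> (a.1 < 2 * n + 4) && (a.2 < 2 * n + 4).
Proof.
move=> /J_arcsP[i [e [lt_in e_in a_e]]].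
have : (e.1 < 6) && (e.2 < 6).
  by apply: (allP (_ : all (fun e => (e.1 < 6) && (e.2 < 6)) base_edges)).
by case: a_e => -> /=; lia.
Qed.

(** The arcs of step [n] join column [n] to a later column or lie inside column [n + 1]. Those of
    earlier steps have an end in a column before [n] or lie inside a column up to [n]. *)
Lemma J_arcs_uniq (n : nat) : uniq (J_arcs n).
Proof.
elim: n => // n IHn; rewrite -addn1 J_arcsD cat_uniq IHn andTb.
rewrite (map_inj_uniq (_ : injective (shift_arc _))) ?andbT //; last first.
  by move=> [u v] [u' v'] [] /addnI-> /addnI->.
apply/hasPn => _ /mapP[a a_in ->]; apply/J_arcsP => -[i [e [lt_in e_in a_e]]].
pose joins_columns (e : nat * nat) := (e.1 < 2) && (2 <= e.2).
pose in_column1 (e : nat * nat) := (2 <= e.1) && (2 <= e.2) && (maxn e.1 e.2 <= 3).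
have a_ok : [|| joins_columns a, joins_columns (a.2, a.1) | in_column1 a].
  by apply: (allP (_ : all (fun a => [|| joins_columns a, joins_columns (a.2, a.1)
    | in_column1 a]) (J_arcs 1))).
have e_ok : joins_columns e || in_column1 e.
  by apply: (allP (_ : all (fun e => joins_columns e || in_column1 e) base_edges)).
move: a_ok e_ok; rewrite /joins_columns /in_column1 /=.
by case: a_e => -[]; lia.
Qed.

(** This decodes the numbering, faithfully for [v < 2 * m + 4], where the argument of [inord] is at
    most [m + 1]. *)
Definition vertex (m v : nat) : Jvertex m := (odd v, inord v./2).

Definition vertex_arc (m : nat) (a : nat * nat) : Jvertex m * Jvertex m :=
  (vertex m a.1, vertex m a.2).

Lemma vertex_inj (m v w : nat) :
  v < 2 * m + 4 -> w < 2 * m + 4 -> vertex m v = vertex m w -> v = w.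
Proof.
move=> lt_v lt_w [odd_vw /(congr1 val)]; rewrite /= !inordK; lia.
Qed.

Lemma vertex_arc_inj (m : nat) : {in J_arcs m &, injective (vertex_arc m)}.
Proof.
move=> [u v] [u' v'] /J_arcs_bound/andP[/= lt_u lt_v] /J_arcs_bound/andP[/= lt_u' lt_v'].
move=> eq_uv; congr (_, _).
  by apply: (vertex_inj lt_u lt_u'); apply: (congr1 fst eq_uv).
by apply: (vertex_inj lt_v lt_v'); apply: (congr1 snd eq_uv).
Qed.

Lemma Jx_vertex (m i : nat) : Jx m i = vertex m (2 * i).
Proof. by rewrite /vertex mul2n odd_double doubleK. Qed.

Lemma Jy_vertex (m i : nat) : Jy m i = vertex m (2 * i + 1).
Proof. by rewrite /vertex mul2n addn1 /= odd_double uphalf_double. Qed.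

Definition vertex_edge (m i : nat) (e : nat * nat) : {set Jvertex m} :=
  [set vertex m (2 * i + e.1); vertex m (2 * i + e.2)].

(** The edge inside column [i] is attributed to step [i.-1], where it is the translate of [(2, 3)];
    all other edges keep their index. *)
Lemma JedgesE (m : nat) :
  Jedges m = (\bigcup_(i < m.+1 | 1 <= i) [set vertex_edge m i.-1 (2, 3)]) :|:
             (\bigcup_(i < m) [set E in map (vertex_edge m i) (behead base_edges)]).
Proof.
congr (_ :|: _); apply: eq_bigr => i hi; rewrite /vertex_edge /=.
  congr [set [set _; _]]; rewrite ?Jx_vertex ?Jy_vertex; congr vertex; lia.
apply/setP => E; rewrite !inE !Jx_vertex !Jy_vertex -!orbA.
have -> : 2 * i.+1 = 2 * i + 2 by lia.
have -> : 2 * i.+2 = 2 * i + 4 by lia.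
by rewrite -!addnA addn0.
Qed.

Lemma mem_Jedges (m : nat) (E : {set Jvertex m}) :
  reflect (exists i e, [/\ i < m, e \in base_edges & E = vertex_edge m i e])
          (E \in Jedges m).
Proof.
rewrite JedgesE inE; apply: (iffP orP) => [[]|[i [e [lt_im]]]].
- case/bigcupP=> i i1 /set1P->; exists i.-1, (2, 3); split=> //.
  by have := ltn_ord i; lia.
- case/bigcupP=> i _; rewrite inE => /mapP[e e_in ->]; exists i, e; split=> //.
  by rewrite inE e_in orbT.
rewrite inE => /orP[/eqP->|e_in] ->; [left | right]; apply/bigcupP.
  by exists (Ordinal (lt_im : i.+1 < m.+1)); rewrite ?set11.
by exists (Ordinal lt_im); rewrite // inE map_f.
Qed.

Lemma eq_set2 (T : finType) (a b c d : T) :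
  [set a; b] = [set c; d] -> (a, b) = (c, d) \/ (a, b) = (d, c).
Proof.
move=> eq_ab.
have : c \in [set a; b] by rewrite eq_ab set21.
have : d \in [set a; b] by rewrite eq_ab set22.
have : b \in [set c; d] by rewrite -eq_ab set22.
have : a \in [set c; d] by rewrite -eq_ab set21.
move=> /set2P[->|->] /set2P[->|->]; rewrite !inE ?orbb; auto.
  by move=> /eqP->; left.
by move=> _ /eqP->; left.
Qed.

Lemma arcs_star_J (m : nat) :
  arcs (star (J m)) = [set a in map (vertex_arc m) (J_arcs m)].
Proof.
apply/setP => a; rewrite [RHS]inE.
have -> : (a \in arcs (star (J m))) = ([set a.1; a.2] \in Jedges m) by rewrite inE.
apply/mem_Jedges/mapP => [[i [e [lt_im e_in]]]|[b]].
  case/eq_set2; rewrite -surjective_pairing => ->.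
    by exists (shift_arc (2 * i) e) => //; apply/J_arcsP; exists i, e; split; auto.
  exists (shift_arc (2 * i) (e.2, e.1)) => //; apply/J_arcsP; exists i, e.
  by split; auto.
case/J_arcsP=> i [e [lt_im e_in b_e]] ->; exists i, e; split=> //.
by case: b_e => ->; rewrite // setUC.
Qed.

(** * Factors as admissible subdigraphs *)

Lemma uniq_flatten_map (I T : eqType) (f : I -> seq T) (r : seq I) (i j : I) (x : T) :
  uniq (flatten (map f r)) -> i \in r -> j \in r -> x \in f i -> x \in f j -> i = j.
Proof.
elim: r => //= k r IHr; rewrite cat_uniq => /and3P[_ /hasPn disj uniq_r].
have notin l : l \in r -> x \in f l -> x \notin f k.
  by move=> rl xl; apply: disj; apply/flattenP; exists (f l); rewrite ?map_f.
rewrite !inE => /predU1P[->|ri] /predU1P[->|rj] xi xj //.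
- by have := notin j rj xj; rewrite xi.
- by have := notin i ri xi; rewrite xj.
- exact: IHr.
Qed.

Lemma card_setI2 (T : finType) (V : {set T}) (u v : T) :
  u != v -> (u \in V) != (v \in V) -> #|V :&: [set u; v]| == 1.
Proof.
move=> neq_uv; case uV: (u \in V); case vV: (v \in V) => // _.
  suff -> : V :&: [set u; v] = [set u] by rewrite cards1.
  apply/setP => w; rewrite !inE andb_orr.
  case: (eqVneq w u) => [->|_]; first by rewrite uV.
  by case: (eqVneq w v) => [->|_]; rewrite ?vV ?andbF.
suff -> : V :&: [set u; v] = [set v] by rewrite cards1.
apply/setP => w; rewrite !inE andb_orr.
case: (eqVneq w v) => [->|_]; first by rewrite vV orbT.
by case: (eqVneq w u) => [->|_]; rewrite ?uV ?andbF.
Qed.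

(** The absence of loops, which a [digraph] has to prove, is inherited from [D]. *)
Lemma cycles_subdigraph (T : finType) (D : digraph T) (cs : seq (seq T)) :
  [set a in flatten (map cycle_arcs cs)] \subset arcs D ->
  exists H : digraph T, verts H = [set v in flatten cs] /\
                        arcs H = [set a in flatten (map cycle_arcs cs)].
Proof.
move=> sub_arcs; have arcs_ok : [forall a in [set a in flatten (map cycle_arcs cs)],
    [&& a.1 \in [set v in flatten cs], a.2 \in [set v in flatten cs] & a.1 != a.2]].
  apply/forall_inP => a a_in.
  have /and3P[_ _ ->] := forall_inP (arcsP D) _ (subsetP sub_arcs _ a_in).
  by case: a a_in => u v; rewrite !inE andbT => /mem_flatten_cycle_arcs.
by exists (Digraph arcs_ok).
Qed.

Section Realization.
Variables (m : nat) (s : seq nat) (D : nat -> factor) (i : nat).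
Hypotheses (m2 : 2 <= m) (s2 : all (leq 2) s) (sum_s : sumn s = 2 * m).
Hypotheses (pdD : partial_decomp false m s D) (i9 : i < 9).

Let cs := map (map (vertex m)) (D i).1.

Lemma factor_arcs_closed : factor_arcs (D i) = flatten (map cycle_arcs (D i).1).
Proof. by rewrite /factor_arcs (pd_ends pdD i9) cats0. Qed.

Lemma factor_arcs_sub : {subset factor_arcs (D i) <= J_arcs m}.
Proof.
move=> a a_in; rewrite -(perm_mem (pd_arcs pdD)); apply/flattenP.
by exists (factor_arcs (D i)); rewrite // (map_f (factor_arcs \o D)) ?mem_iota.
Qed.

Lemma factor_verts :
  perm_eq (flatten (D i).1 ++ occ false i)
          (iota 0 (2 * m) ++ map (addn (2 * m)) (occ false i)).
Proof. by have := pd_verts pdD i9; rewrite (pd_ends pdD i9). Qed.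

Lemma occ_closed : uniq (occ false i) && all (gtn 4) (occ false i).
Proof.
apply: (allP (_ : all (fun i => uniq (occ false i) && all (gtn 4) (occ false i)) (iota 0 9))).
  by [].
by rewrite mem_iota.
Qed.

Lemma factor_verts_uniq : uniq (flatten (D i).1 ++ occ false i).
Proof.
have /andP[uniq_occ /allP occ4] := occ_closed.
rewrite (perm_uniq factor_verts) cat_uniq iota_uniq map_inj_uniq ?uniq_occ; last exact: addnI.
rewrite andbT; apply/hasPn => _ /mapP[v _ ->]; rewrite mem_iota; lia.
Qed.

Lemma factor_verts_bound (v : nat) : v \in flatten (D i).1 -> v < 2 * m + 4.
Proof.
move=> v_in; have : v \in flatten (D i).1 ++ occ false i by rewrite mem_cat v_in.
have /andP[_ /allP occ4] := occ_closed.
rewrite (perm_mem factor_verts) mem_cat mem_iota => /orP[|/mapP[w /occ4 /= w4 ->]]; lia.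
Qed.

Lemma mem_factor_verts (v : nat) :
  v < 2 * m + 4 -> (vertex m v \in flatten cs) = (v \in flatten (D i).1).
Proof.
move=> lt_v; rewrite -map_flatten; apply/mapP/idP => [[w w_in eq_vw]|v_in]; last by exists v.
by rewrite (vertex_inj lt_v (factor_verts_bound w_in) eq_vw).
Qed.

(** As [j < 4 <= 2 * m], [factor_verts] leaves two cases. If [j] is reserved in [occ false i], the
    cycles avoid [j] and contain [2 * m + j]; if not, they contain [j] and avoid [2 * m + j]. *)
Lemma exactly_one_end (V : {set Jvertex m}) (j : nat) :
  V = [set v in flatten cs] -> j < 4 ->
  exactly_one_of V (vertex m j) (vertex m (2 * m + j)).
Proof.
move=> -> j4; apply: card_setI2.
  by apply/eqP => /vertex_inj; lia.
rewrite !inE !mem_factor_verts; try lia.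
have := factor_verts_uniq; rewrite cat_uniq => /and3P[_ /hasPn disj _].
have := perm_mem factor_verts j; have := perm_mem factor_verts (2 * m + j).
have /andP[_ /allP occ4] := occ_closed.
rewrite !mem_cat !mem_iota (mem_map (@addnI _)) /=.
have -> : (2 * m + j \in occ false i) = false by apply/negP => /occ4 /=; lia.
have -> : (j \in map (addn (2 * m)) (occ false i)) = false.
  by apply/negP => /mapP[w _]; lia.
have := disj j; case: (j \in occ false i) => /= [/(_ isT) /negPf|_];
  case: (_ \in flatten _) => //; case: (_ \in flatten _) => //; lia.
Qed.

Lemma factor_realized :
  exists H : digraph (Jvertex m),
    [/\ arcs H = [set a in map (vertex_arc m) (factor_arcs (D i))],
        has_cycle_type H s, admissible H & arcs H != set0].
Proof.
have arcs_cs : map (vertex_arc m) (factor_arcs (D i)) = flatten (map cycle_arcs cs).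
  by rewrite factor_arcs_closed flatten_cycle_arcs_map.
have sub_J : [set a in flatten (map cycle_arcs cs)] \subset arcs (star (J m)).
  rewrite -arcs_cs arcs_star_J; apply/subsetP => a; rewrite !inE => /mapP[b b_in ->].
  by rewrite map_f ?factor_arcs_sub.
have [H [vertsH arcsH]] := cycles_subdigraph sub_J.
have sizes_cs : perm_eq (map size cs) s.
  rewrite -map_comp (eq_map (fun c => size_map (vertex m) c)).
  exact: (pd_sizes pdD i9).
have size2 : all (fun c => 2 <= size c) cs.
  by have := s2; rewrite -(perm_all _ sizes_cs) all_map.
have typeH : has_cycle_type H s.
  apply/has_cycle_typeP; exists cs; split=> //.
  rewrite -map_flatten map_inj_in_uniq => [|v w v_in w_in].
    by have := factor_verts_uniq; rewrite cat_uniq => /andP[].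
  exact: (vertex_inj (factor_verts_bound v_in) (factor_verts_bound w_in)).
exists H; split=> //; first by rewrite arcs_cs.
  split.
  - by rewrite /subdigraph arcsH sub_J subsetT.
  - by exists s.
  - by rewrite (has_cycle_type_dorder typeH).
  have ends j k l : k = j -> l = 2 * m + j -> j < 4 ->
      exactly_one_of (verts H) (vertex m k) (vertex m l).
    by move=> -> ->; apply: exactly_one_end.
  rewrite !Jx_vertex !Jy_vertex; apply/and4P.
  (* The codes of x_0, x_1, y_0 and y_1 are 0, 2, 1 and 3. *)
  by split; [apply: (ends 0) | apply: (ends 2) | apply: (ends 1) | apply: (ends 3)]; lia.
(* A partition has no empty class. Here [s] is nonempty because its sum is positive, and the first
   arc of the first cycle is a witness. *)
rewrite arcsH; case: cs size2 sizes_cs => [|c cs'] /=.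
  by move=> _ /perm_sumn /=; rewrite sum_s; lia.
case: c => // x p _ _; apply/set0Pn; exists (x, head x (rcons p x)).
by rewrite inE mem_cat /cycle_arcs rot1_cons; case: (p) => [|y q]; rewrite /= mem_head.
Qed.
End Realization.

(** * Assembling the nine arc classes *)

Theorem theorem4p21 (m : nat) (T : finType) (F : digraph T) :
  4 <= m ->
  bipartite_two_regular F ->
  dorder F = 2 * m ->
  ~ has_cycle_type F (nseq m 2) ->
  exists P : {set {set Jvertex m * Jvertex m}}, admissible_decomposition F P.
Proof.
move=> m4 [s typeF even_s] orderF not2.
have sum_s : sumn s = 2 * m by rewrite -orderF (has_cycle_type_dorder typeF).
have s2 : all (leq 2) s.
  by have [cs [perm_cs size_cs _ _ _]] := typeF; rewrite -(perm_all _ perm_cs) all_map.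
pose ks := map half s.
have s_ks : s = map double ks.
  rewrite -map_comp -[LHS]map_id; apply/eq_in_map => k /(allP even_s) even_k.
  by rewrite /= even_halfK.
have sum_ks : sumn ks = m.
  by move: sum_s; rewrite s_ks sumn_map_double; lia.
have [D pdD] : exists D, partial_decomp false m s D.
  rewrite s_ks -sum_ks; apply: decomposable_all.
  - by rewrite all_map; apply: sub_all s2 => k /=; lia.
  - by rewrite sum_ks; lia.
  (* If all half-lengths were 1, [F] would consist of [m] directed 2-cycles. *)
  apply/negP => /all_pred1P ks1; apply: not2.
  suff -> : nseq m 2 = s by [].
  rewrite s_ks -{1}sum_ks ks1 sumn_nseq mul1n.
  by elim: (size ks) => //= n ->.
have [x2 _] : exists x, x \in verts F.
  by apply/card_gt0P; rewrite -/(dorder F) orderF; lia.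
have realized (i : 'I_9) := factor_realized (ltnW (ltnW m4)) s2 sum_s pdD (ltn_ord i).
pose B (i : 'I_9) := [set a in map (vertex_arc m) (factor_arcs (D i))].
exists (B @: setT); split; last first.
  move=> _ /imsetP[i _ ->]; have [H [arcsH typeH admH _]] := realized i.
  by exists H; split=> //; apply: isomorphic_cycle_type typeH typeF.
have B0 : set0 \notin B @: setT.
  apply/negP => /imsetP[i _]; have [H [arcsH _ _]] := realized i.
  by rewrite arcsH => /eqP nB0 /esym.
(* The nine arc lists concatenate to a list without repetitions, and [vertex_arc] is injective on
   it, so a common arc determines the index. *)
have disj : {in setT &, forall i j, j != i -> [disjoint B i & B j]}.
  move=> i j _ _; apply: contraR => /pred0Pn[a /andP[]] /=; rewrite !inE.
  move=> /mapP[b b_i ->] /mapP[b' b'_j eq_b].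
  have Jb := factor_arcs_sub pdD (ltn_ord i) b_i.
  have Jb' := factor_arcs_sub pdD (ltn_ord j) b'_j.
  rewrite -(vertex_arc_inj Jb Jb' eq_b) in b'_j.
  apply/eqP/val_inj; apply: (@uniq_flatten_map _ _ (factor_arcs \o D) (iota 0 9) _ _ b).
  - by rewrite (perm_uniq (pd_arcs pdD)) J_arcs_uniq.
  - by rewrite mem_iota /= ltn_ord.
  - by rewrite mem_iota /= ltn_ord.
  - exact: b'_j.
  - exact: b_i.
have [trivB _] := trivIimset disj B0.
rewrite /partition trivB B0 cover_imset !andbT arcs_star_J; apply/eqP/setP => a.
apply/bigcupP/idP => [[i _]|]; rewrite !inE => /mapP[b b_in ->].
  by rewrite map_f ?(factor_arcs_sub pdD (ltn_ord i)).
move: b_in; rewrite -(perm_mem (pd_arcs pdD)) => /flattenP[_ /mapP[i i9 ->] b_in].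
rewrite mem_iota in i9; exists (Ordinal (i9 : i < 9)); rewrite // inE.
exact: map_f.
Qed.
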